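(* Let $\theta\in C_n$ be a cyclic permutation of $\{1,\dots,n\}$, and let $\eta=\theta^*\circ\rho_{i_1}\circ\rho_{i_2}\circ\cdots\circ\rho_{i_m}\in S_{2n}$ with $1\le i_1<i_2<\cdots<i_m\le n$. Let $M(\eta)=[b_{i,j}]_{1\le i,j\le 2n-1}$ be the adjacency matrix of $G(\eta)$. Then in $G(\eta)$ there is no directed edge from $\mathcal W_2$ to $\mathcal W_1$, that is, $$b_{2i-1,2j}=0\qquad\text{for all }1\le i\le n,\ 1\le j\le n-1.$$ Moreover, the induced subgraph $G(\eta)|_{\mathcal W_2}$ consists of an $n$-cycle induced by $\theta$, namely, for all $1\le i,j\le n$, $$b_{2i-1,2j-1}=\begin{cases}1&\text{if } j=\theta(i),\\ 0&\text{otherwise.}\end{cases}$$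
   Context: $S_n$ is the group of permutations of $\{1,\dots,n\}$, and $C_n\subset S_n$ is the set of cyclic permutations of length $n$, i.e. bijections $\theta$ of $\{1,\dots,n\}$ with $\theta^k(1)\ne 1$ for $1\le k<n$. For $\theta\in C_n$, the permutation $\theta^*\in S_{2n}$ is defined by $\theta^*(2k)=2\theta(k)$ and $\theta^*(2k-1)=2\theta(k)-1$ for $k\in\{1,\dots,n\}$. For $s\in\{1,\dots,n\}$, $\rho_s$ is the transposition exchanging $2s-1$ and $2s$. Composition is of functions, right factor applied first. The number $m$ of transpositions may be odd or even ($m=0$, giving $\eta=\theta^*$, is allowed). For a permutation $\tau\in S_N$, $L_\tau:[1,N]\to[1,N]$ is the continuous map that agrees with $\tau$ on $\{1,\dots,N\}$ and is linear (affine) on each interval $I_i=[i,i+1]$, $1\le i\le N-1$. The digraph $G(\tau)$ has $N-1$ vertices indexed by $1,\dots,N-1$, with a directed edge from vertex $i$ to vertex $j$ (loops allowed) exactly when $I_j\subset L_\tau(I_i)$. The adjacency matrix of $G(\tau)$ is the $(N-1)\times(N-1)$ matrix whose $(i,j)$ entry is $1$ if $I_j\subset L_\tau(I_i)$ and $0$ otherwise. Denote the vertices of $G(\eta)$ by $w_1,\dots,w_{2n-1}$. Put $\mathcal W_1=\{w_2,w_4,\dots,w_{2n-2}\}$ and $\mathcal W_2=\{w_1,w_3,\dots,w_{2n-1}\}$; $G(\eta)|_{\mathcal W_2}$ is the subgraph of $G(\eta)$ induced on $\mathcal W_2$ (all edges of $G(\eta)$ between vertices of $\mathcal W_2$). The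 $n$-cycle induced by $\theta$ is the directed cycle $w_1\to w_{2\theta(1)-1}\to w_{2\theta^2(1)-1}\to\cdots\to w_{2\theta^{n-1}(1)-1}\to w_1$. *)

(* Defs.v *)
From HB Require Import structures.
From mathcomp Require Import all_boot all_order all_fingroup all_algebra.
From mathcomp Require Import all_classical all_reals all_analysis.

Set Implicit Arguments.
Unset Strict Implicit.
Unset Printing Implicit Defensive.

Import Order.TTheory GRing.Theory Num.Theory.
Import numFieldNormedType.Exports.
Local Open Scope classical_set_scope.
Local Open Scope ring_scope.

(* The elements and indices 1, 2, ... of the mathematical text are encoded by
   ordinals starting from 0: the ordinal i always stands for the label i.+1. *)

Definition first n (n_gt0 : (0 < n)%N) : 'I_n := Ordinal n_gt0.

Definition cyclic_perm n (n_gt0 : (0 < n)%N) (theta : 'S_n) : Prop :=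
  forall k : nat, (0 < k < n)%N ->
    (theta ^+ k)%g (first n_gt0) <> first n_gt0.

Fact half_subproof n (p : 'I_n.*2) : (p./2 < n)%N.
Proof. by rewrite ltn_half_double. Qed.
Definition half_ord n (p : 'I_n.*2) : 'I_n := Ordinal (half_subproof p).

Fact pt_odd_subproof n (k : 'I_n) : (k.*2 < n.*2)%N.
Proof. by rewrite ltn_double. Qed.
Fact pt_even_subproof n (k : 'I_n) : (k.*2.+1 < n.*2)%N.
Proof. by rewrite ltn_Sdouble. Qed.

(* If k stands for the label s = k + 1, then pt_odd k stands for the label
   2s - 1 = 2k + 1 and pt_even k for the label 2s = 2k + 2. *)
Definition pt_odd n (k : 'I_n) : 'I_n.*2 := Ordinal (pt_odd_subproof k).
Definition pt_even n (k : 'I_n) : 'I_n.*2 := Ordinal (pt_even_subproof k).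

(* The test [odd p] concerns the 0-based ordinal, whose label is even. *)
Definition star_fun n (theta : 'S_n) (p : 'I_n.*2) : 'I_n.*2 :=
  if odd p then pt_even (theta (half_ord p)) else pt_odd (theta (half_ord p)).

Fact star_inj n (theta : 'S_n) : injective (star_fun theta).
Proof.
move=> p q /(congr1 val); rewrite /star_fun => Epq; apply: val_inj => /=.
have Eo : odd p = odd q.
  by move: Epq; case: (odd p); case: (odd q) => //= /(congr1 odd) /=;
     rewrite !odd_double.
have Eh : half_ord p = half_ord q.
  apply: (@perm_inj _ theta); apply: val_inj.
  by move: Epq; rewrite Eo; case: (odd q) => /= [[]|] /double_inj.
by rewrite -[val p]odd_double_half -[val q]odd_double_half Eo
           (congr1 val Eh : p./2 = q./2).
Qed.

Definition star n (theta : 'S_n) : 'S_n.*2 := perm (@star_inj n theta).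

Lemma star_even n (theta : 'S_n) (k : 'I_n) :
  star theta (pt_even k) = pt_even (theta k).
Proof.
rewrite permE /star_fun /= odd_double /=; congr (pt_even (theta _)).
by apply: val_inj; rewrite /= uphalf_double.
Qed.

Lemma star_odd n (theta : 'S_n) (k : 'I_n) :
  star theta (pt_odd k) = pt_odd (theta k).
Proof.
rewrite permE /star_fun /= odd_double /=; congr (pt_odd (theta _)).
by apply: val_inj; rewrite /= doubleK.
Qed.

Definition rho n (s : 'I_n) : 'S_n.*2 := tperm (pt_odd s) (pt_even s).

(* Products of permutations in the library apply the left factor first. *)
Definition comp_perm N (s t : 'S_N) : 'S_N := (t * s)%g.

Lemma comp_permE N (s t : 'S_N) (i : 'I_N) : comp_perm s t i = s (t i).
Proof. exact: permM. Qed.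

(* theta^* o rho_{i_1} o ... o rho_{i_m} for s = [:: i_1; ...; i_m] *)
Definition eta n (theta : 'S_n) (s : seq 'I_n) : 'S_n.*2 :=
  foldl (@comp_perm n.*2) (star theta) [seq rho i | i <- s].

(* The value of tau in terms of labels; it is only meaningful on labels k
   with 1 <= k <= N. *)
Definition label_val N (tau : 'S_N) (k : nat) : nat :=
  if insub k.-1 is Some i then (tau i).+1 else 0.

Lemma label_valE N (tau : 'S_N) (i : 'I_N) : label_val tau i.+1 = (tau i).+1.
Proof. by rewrite /label_val /= valK. Qed.

(* Only the values on [1, N] matter. *)
Definition Lmap (R : realType) N (tau : 'S_N) (x : R) : R :=
  let k := Num.truncn x in
  (label_val tau k)%:R +
  (x - k%:R) * ((label_val tau k.+1)%:R - (label_val tau k)%:R).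

Definition Iint (R : realType) N (i : 'I_N.-1) : set R :=
  `[(i.+1)%:R, (i.+2)%:R]%classic.
Arguments Iint R {N} i.

Lemma Lmap_label (R : realType) N (tau : 'S_N) (i : 'I_N) :
  Lmap tau (i.+1)%:R = ((tau i).+1)%:R :> R.
Proof. by rewrite /Lmap natrK subrr mul0r addr0 label_valE. Qed.

Lemma Lmap_affine (R : realType) N (tau : 'S_N) (i : 'I_N.-1) (x : R) :
  Iint R i x ->
  Lmap tau x = (label_val tau i.+1)%:R +
    (x - (i.+1)%:R) * ((label_val tau i.+2)%:R - (label_val tau i.+1)%:R).
Proof.
rewrite /Iint /= in_itv /= => /andP[ix].
rewrite le_eqVlt => /predU1P[-> | xi]; rewrite /Lmap; last first.
  by rewrite (@truncn_def _ x i.+1) // ix xi.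
rewrite natrK subrr mul0r addr0 [in _ - _]mulrSr [_%:R + 1 - _]addrAC.
by rewrite subrr add0r mul1r addrC subrK.
Qed.

Lemma Lmap_continuous (R : realType) N (tau : 'S_N) :
  {within `[1, N%:R], continuous (@Lmap R N tau)}.
Proof.
case: N tau => [|N] tau.
  have -> : `[1, 0%:R]%classic = set0 :> set R by rewrite set_itv_ge // bnd_simp ler10.
  exact: continuous_subspace0.
suff H m : (m <= N)%N -> {within `[1, m.+1%:R], continuous (@Lmap R _ tau)}.
  exact: H.
elim: m => [_|m IHm ltmN]; first by rewrite set_itv1; exact: continuous_subspace1.
have -> : `[1, m.+2%:R]%classic =
      `[1, m.+1%:R]%classic `|` `[m.+1%:R, m.+2%:R]%classic :> set R.
  apply/seteqP; split => x /=; rewrite !in_itv /=.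
    move=> /andP[x1 x2]; case: (leP x m.+1%:R) => xm; [left|right].
      by rewrite x1.
    by rewrite x2 ltW.
  case=> /andP[x1 x2]; rewrite ?x1 ?x2 /=.
    by rewrite (le_trans x2) // ler_nat.
  by rewrite andbT (le_trans _ x1) // ler1n.
apply: withinU_continuous; [exact: interval_closed|exact: interval_closed|exact: IHm (ltnW ltmN)|].
pose i : 'I_N.+1.-1 := Ordinal ltmN.
pose f (x : R) := (label_val tau i.+1)%:R +
    (x - (i.+1)%:R) * ((label_val tau i.+2)%:R - (label_val tau i.+1)%:R) : R.
apply: (@subspace_eq_continuous _ _ _ f).
  by move=> x; rewrite inE => /(@Lmap_affine R _ tau i) /esym.
apply: continuous_subspaceT => x; apply: cvgD; first exact: cvg_cst.
apply: cvgM; last exact: cvg_cst.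
by apply: cvgB; [exact: cvg_id | exact: cvg_cst].
Qed.

Definition digraph (R : realType) N (tau : 'S_N) : rel 'I_N.-1 :=
  fun i j => `[< Iint R j `<=` @Lmap R N tau @` Iint R i >].

Definition adjmx (R : realType) N (tau : 'S_N) : 'M[int]_N.-1 :=
  \matrix_(i, j) (digraph R tau i j)%:R.

Fact w_odd_subproof n (i : 'I_n) : (i.*2 < n.*2.-1)%N.
Proof. by case: n i => [[]|n] //= i; rewrite ltnS leq_double -ltnS. Qed.
Fact w_even_subproof n (j : 'I_n.-1) : (j.*2.+1 < n.*2.-1)%N.
Proof. by case: n j => [[]|n] //= j; rewrite ltnS ltn_double. Qed.

(* If i stands for the label a, then w_odd i is w_{2a-1} and w_even i is
   w_{2a}. *)
Definition w_odd n (i : 'I_n) : 'I_n.*2.-1 := Ordinal (w_odd_subproof i).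
Definition w_even n (j : 'I_n.-1) : 'I_n.*2.-1 := Ordinal (w_even_subproof j).

Definition W1 n : {set 'I_n.*2.-1} := [set w_even j | j : 'I_n.-1]%SET.
Definition W2 n : {set 'I_n.*2.-1} := [set w_odd i | i : 'I_n]%SET.

(* The vertices w_1, w_{2 theta(1) - 1}, ..., w_{2 theta^{n-1}(1) - 1} of the
   cycle induced by theta, in order. *)
Definition induced_cycle n (n_gt0 : (0 < n)%N) (theta : 'S_n) :
    seq 'I_n.*2.-1 :=
  [seq w_odd ((theta ^+ k)%g (first n_gt0)) | k <- iota 0 n].

(* The subgraph of e induced on W consists of the directed cycle c: the
   entries of c are distinct, they are the vertices in W, and the edges between
   vertices of W are exactly those from an entry of c to the cyclically next
   one. *)
Definition induced_subgraph_is_cycle (V : finType) (e : rel V) (W : {set V})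
    (c : seq V) : Prop :=
  [/\ uniq c, c =i W & {in W &, forall u v, e u v = (v == next c u)}].

(* Main.v *)
(* Whatever the transpositions are, eta maps the pair {2k-1, 2k} onto the pair
   {2 theta(k) - 1, 2 theta(k)}. Hence L_eta maps the interval I_{2k-1} exactly
   onto I_{2 theta(k) - 1}, which contains no other basic interval: the only
   edge leaving w_{2k-1} goes to w_{2 theta(k) - 1}. *)
Require Import Defs.
From mathcomp Require Import all_boot all_order all_fingroup all_algebra.
From mathcomp Require Import all_classical all_reals all_analysis.
From mathcomp Require Import lra zify.

Import Order.TTheory GRing.Theory Num.Theory.

Local Open Scope ring_scope.

Lemma half_rho n (s : 'I_n) (p : 'I_n.*2) : half_ord (rho s p) = half_ord p.
Proof.
rewrite /rho; case: tpermP => [->|->|_ _] //; apply: val_inj => /=;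
  by rewrite doubleK uphalf_double.
Qed.

(** Each [rho] moves points only within a pair, so on pairs [eta] acts as [star theta] does, that
    is, as [theta]. *)
Lemma half_eta n (theta : 'S_n) (s : seq 'I_n) (p : 'I_n.*2) :
  half_ord (eta theta s p) = theta (half_ord p).
Proof.
rewrite /eta; have: forall p, half_ord (star theta p) = theta (half_ord p).
  move=> q; rewrite permE /star_fun; apply: val_inj.
  by case: odd; rewrite /= ?uphalf_double ?doubleK.
(* The accumulator of [foldl] changes at each step, so [star theta] is generalised to any [tau] that
   induces [theta] on pairs. *)
elim: s (star theta) p => [|i s IHs] tau p //= Htau.
by apply: IHs => q; rewrite comp_permE Htau half_rho.
Qed.

(** Both images have half [theta i] and they differ by injectivity, so they fill the pair over
    [theta i] in one of the two orders. *)
Lemma eta_pair n (theta : 'S_n) (s : seq 'I_n) (i : 'I_n)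
    (o := eta theta s (pt_odd i)) (e := eta theta s (pt_even i)) :
  (o = (theta i).*2 :> nat /\ e = (theta i).*2.+1 :> nat) \/
  (o = (theta i).*2.+1 :> nat /\ e = (theta i).*2 :> nat).
Proof.
have ho : o./2 = theta i.
  rewrite [LHS](congr1 val (half_eta _ theta s _)) /=; congr (nat_of_ord (theta _)).
  by apply: val_inj; rewrite /= doubleK.
have he : e./2 = theta i.
  rewrite [LHS](congr1 val (half_eta _ theta s _)) /=; congr (nat_of_ord (theta _)).
  by apply: val_inj; rewrite /= uphalf_double.
have oe : o != e :> nat.
  by apply/eqP => /val_inj/perm_inj/(congr1 val) /=; lia.
lia.
Qed.

(** On this interval the map is affine of slope 1 or -1, according to the two cases of [eta_pair],
    and either way it is onto the target interval. *)
Lemma Lmap_w_odd (R : realType) n (theta : 'S_n) (s : seq 'I_n) (i : 'I_n) :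
  (@Lmap R _ (eta theta s) @` Iint R (w_odd i) = Iint R (w_odd (theta i)))%classic.
Proof.
have L x : Iint R (w_odd i) x -> Lmap (eta theta s) x =
    (eta theta s (pt_odd i)).+1%:R + (x - i.*2.+1%:R) *
    ((eta theta s (pt_even i)).+1%:R - (eta theta s (pt_odd i)).+1%:R).
  by move/Lmap_affine => ->; rewrite -!label_valE.
(* [c] is the left endpoint of the source, but [t] is a 0-based value: the target is
   [t + 1, t + 2]. *)
set t := (theta i).*2; set c : R := i.*2.+1%:R.
have Ii y : Iint R (w_odd i) y = (c <= y <= c + 1) :> Prop.
  by rewrite /Iint /= in_itv /= -[_.+2%:R]natr1.
have It y : Iint R (w_odd (theta i)) y = (t%:R + 1 <= y <= t%:R + 2) :> Prop.
  by rewrite /Iint /= in_itv /= -[_.+2%:R]natr1 -natr1 -addrA.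
have t2 : t.+2%:R = t%:R + 2 :> R by rewrite -addn2 natrD.
have t1 : t.+1%:R = t%:R + 1 :> R by rewrite -addn1 natrD.
apply/seteqP; split => [_ [x ix <-]|y].
  rewrite L// It; move: ix; rewrite Ii.
  case: (eta_pair _ theta s i) => -[-> ->]; rewrite -/t -/c t1 t2; lra.
rewrite It => iy; case: (eta_pair _ theta s i) => -[eo ee].
  (* Preimage under the increasing map x |-> t + 1 + (x - c). *)
  exists (y - t%:R - 1 + c); first by rewrite Ii; lra.
  rewrite L ?Ii; last by lra.
  rewrite eo ee -/t -/c t1 t2; lra.
(* Preimage under the decreasing map x |-> t + 2 - (x - c). *)
exists (t%:R + 2 - y + c); first by rewrite Ii; lra.
rewrite L ?Ii; last by lra.
rewrite eo ee -/t -/c t1 t2; lra.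
Qed.

Lemma Iint_sub (R : realType) N (i j : 'I_N.-1) :
  (Iint R i `<=` Iint R j)%classic <-> i = j.
Proof.
split=> [sub|-> //]; apply: val_inj => /=.
(* Testing the two endpoints of the smaller interval already forces i = j. *)
have := sub i.+1%:R; have := sub i.+2%:R.
by rewrite /Iint /= !in_itv /= !ler_nat; lia.
Qed.

Lemma w_odd_inj n : injective (@w_odd n).
Proof. by move=> i j /(congr1 val) /double_inj /val_inj. Qed.

Lemma digraph_w_odd (R : realType) n (theta : 'S_n) (s : seq 'I_n) (i : 'I_n)
    (v : 'I_n.*2.-1) :
  digraph R (eta theta s) (w_odd i) v = (v == w_odd (theta i)).
Proof.
rewrite /digraph Lmap_w_odd; apply/asboolP/eqP.
  exact: (Iint_sub _ _ _ _).1.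
exact: (Iint_sub _ _ _ _).2.
Qed.

Lemma w_even_neq_odd n (j : 'I_n.-1) (i : 'I_n) : (w_even j == w_odd i) = false.
Proof. by apply/eqP => /(congr1 val) /=; lia. Qed.

(** The order is positive, and that power of [theta] fixes the first point; an order below n would
    contradict cyclicity. *)
Lemma cyclic_order n (n_gt0 : (0 < n)%N) (theta : 'S_n) :
  cyclic_perm n_gt0 theta -> fingraph.order theta (first n_gt0) = n.
Proof.
move=> cyc; apply/eqP; rewrite eqn_leq -{1}[n in (_ <= n)%N]card_ord max_card /=.
rewrite leqNgt; apply/negP => lt_n; apply: (cyc (fingraph.order theta (first n_gt0))).
  by rewrite fingraph.order_gt0.
by rewrite permX iter_order //; exact: perm_inj.
Qed.

(** Gives access to the general facts on orbits: distinct entries and successor [theta i]. *)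
Lemma induced_cycleE n (n_gt0 : (0 < n)%N) (theta : 'S_n) :
  cyclic_perm n_gt0 theta ->
  induced_cycle n_gt0 theta = [seq w_odd i | i <- fingraph.orbit theta (first n_gt0)].
Proof.
move=> cyc; rewrite /fingraph.orbit cyclic_order // /induced_cycle.
apply: (@eq_from_nth _ (w_odd (first n_gt0))) => [|k].
  by rewrite !size_map size_iota size_traject.
rewrite size_map size_iota => ltkn.
rewrite (nth_map 0%N) ?size_iota // nth_iota // add0n permX.
by rewrite (nth_map (first n_gt0)) ?size_traject // nth_traject.
Qed.

(** The orbit has n distinct entries, hence exhausts ['I_n]. *)
Lemma mem_cyclic_orbit n (n_gt0 : (0 < n)%N) (theta : 'S_n) (i : 'I_n) :
  cyclic_perm n_gt0 theta -> i \in fingraph.orbit theta (first n_gt0).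
Proof.
move=> cyc; have /subset_cardP sub : #|fingraph.orbit theta (first n_gt0)| = #|'I_n|.
  by rewrite (card_uniqP (orbit_uniq _ _)) size_orbit cyclic_order // card_ord.
by rewrite (sub (subset_predT _)).
Qed.

Theorem lemma3p2 (R : realType) (n : nat) (n_gt0 : (0 < n)%N)
    (theta : 'S_n) (theta_cyclic : cyclic_perm n_gt0 theta)
    (s : seq 'I_n) (s_incr : sorted (fun i j : 'I_n => (i < j)%N) s) :
  [/\ {in W2 n & W1 n, forall u v, ~~ digraph R (eta theta s) u v},
      forall (i : 'I_n) (j : 'I_n.-1),
        adjmx R (eta theta s) (w_odd i) (w_even j) = 0,
      induced_subgraph_is_cycle (digraph R (eta theta s)) (W2 n)
        (induced_cycle n_gt0 theta)
    & forall i j : 'I_n,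
        adjmx R (eta theta s) (w_odd i) (w_odd j)
          = if j == theta i then 1 else 0].
Proof.
split.
- move=> u v /imsetP[i _ ->] /imsetP[j _ ->].
  by rewrite digraph_w_odd w_even_neq_odd.
- by move=> i j; rewrite mxE digraph_w_odd w_even_neq_odd.
- rewrite induced_cycleE //; split.
  + by rewrite (map_inj_uniq (w_odd_inj n)) orbit_uniq.
  + move=> v; apply/mapP/imsetP => -[i _ ->]; exists i => //.
    exact: mem_cyclic_orbit.
  + move=> u v /imsetP[i _ ->] _.
    (* [next] commutes with the injective [w_odd], so the claim reduces to the successor of [i] in
       the orbit. *)
    rewrite digraph_w_odd (next_map (w_odd_inj n)) ?orbit_uniq //.
    have /eqP-> // := next_cycle (fingraph.cycle_orbit (@perm_inj _ theta) _)
                                 (mem_cyclic_orbit _ _ _ i theta_cyclic).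
- move=> i j; rewrite mxE digraph_w_odd (inj_eq (w_odd_inj n)).
  by case: eqP.
Qed.
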